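(* Let $n$ be a positive integer, $I$ an index set, and $(A_i)_{i\in I}$ a family of pairwise commuting matrices in $M_n(\mathbb{C})$ such that the sum $\sum_{i\in I} A_i^* A_i$ converges. Then there is a family $(B_i)_{i\in I}$ of pairwise commuting normal matrices in $M_n(\mathbb{C})$ such that $$\sum_{i\in I}\|A_i-B_i\|_2^2\le n\cdot sw\Big(\sum_{i\in I}A_i^*A_i\Big).$$
   Context: $M_n(\mathbb{C})$ denotes the complex $n\times n$ matrices acting on $\mathbb{C}^n$ with its standard inner product $\langle\cdot\mid\cdot\rangle$ (linear in the second variable). For $A=(a_{jk})\in M_n(\mathbb{C})$, $\|A\|_2=\big(\sum_{j,k}|a_{jk}|^2\big)^{1/2}$ is the Hilbert–Schmidt (Frobenius) norm. The numerical range of an operator $A$ is $W(A)=\{\langle \xi\mid A\xi\rangle : \|\xi\|=1\}\subset\mathbb{C}$, and the numerical spread is $sw(A)=\operatorname{diam}W(A)=\sup_{z,z'\in W(A)}|z-z'|$. The sum over the (possibly infinite) index set is the limit of the net of finite partial sums. *)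

(* Defs.v *)
From HB Require Import structures.
From mathcomp Require Import all_boot all_order all_algebra.
From mathcomp Require Import all_classical all_reals.
From mathcomp Require Import ereal esum.
From mathcomp.real_closed Require Import complex.
Set Implicit Arguments. Unset Strict Implicit. Unset Printing Implicit Defensive.
Import Order.TTheory GRing.Theory Num.Theory.
Local Open Scope ring_scope.
Local Open Scope classical_set_scope.

Section Defs.
Variable R : realType.
Local Notation C := R[i].

Definition cabs2 (z : C) : R := (complex.Re z) ^+ 2 + (complex.Im z) ^+ 2.
Definition cabs (z : C) : R := Num.sqrt (cabs2 z).

Variable n : nat.

Definition adj (A : 'M[C]_n) : 'M[C]_n := \matrix_(i, j) (A j i)^*.

Definition normal_cmx (A : 'M[C]_n) : Prop := adj A *m A = A *m adj A.

Definition hs2 (A : 'M[C]_n) : R := \sum_(j < n) \sum_(k < n) cabs2 (A j k).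

Definition cdot (u v : 'cV[C]_n) : C := \sum_(j < n) (u j 0)^* * v j 0.

Definition vnorm2 (u : 'cV[C]_n) : R := \sum_(j < n) cabs2 (u j 0).

Definition numrange (A : 'M[C]_n) : set C :=
  [set z | exists xi : 'cV[C]_n, vnorm2 xi = 1 /\ z = cdot xi (A *m xi)].

Definition numspread (A : 'M[C]_n) : R :=
  sup [set cabs (z - z') | z in numrange A & z' in numrange A].

(* The sum over I of F converges to S: limit of the net of finite partial
   sums (finite subsets of I directed by inclusion), in Hilbert--Schmidt norm. *)
Definition has_sum (I : choiceType) (F : I -> 'M[C]_n) (S : 'M[C]_n) : Prop :=
  forall e : R, 0 < e -> exists J0 : set I, finite_set J0 /\
    forall J : set I, finite_set J -> J0 `<=` J ->
      Num.sqrt (hs2 ((\sum_(i \in J) F i)%R - S)) < e.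

End Defs.

(* Main.v *)
(* Choose a unitary P making every T_i = P A_i P^* triangular, and let B_i be
   P^* diag(T_i) P.  With x_j the j-th column of P^*, the off-diagonal part of
   the j-th column of T_i has squared norm |A_i x_j|^2 - |(T_i)_jj|^2.  Since the
   A_i commute, the diagonal entries ((T_i)_jj)_i have a joint unit eigenvector
   xi_j, so that |(T_i)_jj|^2 = |A_i xi_j|^2.  Summing over i,
   sum_i |A_i - B_i|_2^2 = sum_j (<x_j, S x_j> - <xi_j, S xi_j>), and both
   terms of each of the n differences belong to W(S). *)
Require Import Defs.
From HB Require Import structures.
From mathcomp Require Import all_boot all_order all_algebra.
From mathcomp Require Import all_classical all_reals.
From mathcomp Require Import ereal esum spectral.
From mathcomp Require Import lra.
From mathcomp.real_closed Require Import complex.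
Import Order.TTheory GRing.Theory Num.Theory.
Local Open Scope ring_scope.
Local Open Scope classical_set_scope.

(** * Joint eigenvectors of commuting triangular matrices *)

(** Replace [x] by its last nonzero multiple [a ^+ m * x], which [a] kills, and recurse on the
    remaining elements: they stay nilpotent on it because they commute with [a]. The commutation
    clause on [k] is carried through the induction so that [a] can be moved past the multiplier
    found for the tail. *)
Lemma common_annihilator (R : nzRingType) (s : seq R) (x : R) :
  {in s &, forall a b, GRing.comm a b} -> x != 0 ->
  (forall a, a \in s -> exists m, a ^+ m * x = 0) ->
  exists k, [/\ k * x != 0,
    forall b, (forall a, a \in s -> GRing.comm b a) -> GRing.comm b k &
    forall a, a \in s -> a * (k * x) = 0].
Proof.
elim: s x => [|a s IHs] x comm_s x0 nil_s.
  by exists 1; rewrite mul1r; split=> // b _; exact: commr1.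
have comm_as b : b \in a :: s -> GRing.comm a b.
  by apply: comm_s; rewrite mem_head.
have ex_m : exists m, a ^+ m * x == 0.
  by have [m /eqP] := nil_s a (mem_head a s); exists m.
case: (ex_minnP ex_m) => -[|m] /eqP amx0 min_m.
  by rewrite mul1r in amx0; rewrite amx0 eqxx in x0.
have amx_neq0 : a ^+ m * x != 0 by apply/negP => /min_m; rewrite ltnn.
have [b c bs cs|b bs|k [kx0 comm_k kill_k]] := IHs _ _ amx_neq0.
- by apply: comm_s; rewrite inE ?bs ?cs orbT.
- have [|l blx0] := nil_s b; first by rewrite inE bs orbT.
  exists l; rewrite mulrA (commrX m (commr_sym (commrX l (comm_as b _)))).
    by rewrite -mulrA blx0 mulr0.
  by rewrite inE bs orbT.
exists (k * a ^+ m); rewrite -mulrA; split=> // [b comm_b|b].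
  apply: commrM; last by apply: commrX; apply: comm_b; rewrite mem_head.
  by apply: comm_k => c cs; apply: comm_b; rewrite inE cs orbT.
rewrite inE => /predU1P[->|/kill_k //].
rewrite mulrA (comm_k a) => [|c cs]; last by apply: comm_as; rewrite inE cs orbT.
by rewrite -mulrA (mulrA a) -exprS amx0 mulr0.
Qed.

Lemma mulmx_trig (R : pzRingType) n (A B : 'M[R]_n) :
  is_trig_mx A -> is_trig_mx B ->
  is_trig_mx (A *m B) /\ forall i, (A *m B) i i = A i i * B i i.
Proof.
move=> /is_trig_mxP trigA /is_trig_mxP trigB; split.
  apply/is_trig_mxP => i j ltij; rewrite mxE big1 // => k _.
  have [ltik|leki] := ltnP i k; first by rewrite trigA ?mul0r.
  by rewrite trigB ?mulr0 // (leq_ltn_trans leki).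
move=> i; rewrite mxE (bigD1 i) //= big1 ?addr0 // => k neqki.
case: (ltngtP k i) => [ltki|ltik|/val_inj eqki].
- by rewrite trigB ?mulr0.
- by rewrite trigA ?mul0r.
- by rewrite eqki eqxx in neqki.
Qed.

Lemma horner_mx_trig (R : comNzRingType) n (A : 'M[R]_n.+1) (p : {poly R}) :
  is_trig_mx A ->
  is_trig_mx (horner_mx A p) /\ forall i, horner_mx A p i i = p.[A i i].
Proof.
move=> trigA; elim/poly_ind: p => [|p c [trigp diagp]].
  by rewrite rmorph0; split=> [|i]; rewrite ?mx0_is_trig // horner0 mxE.
have [trigpA diagpA] := mulmx_trig _ _ _ _ trigp trigA.
rewrite rmorphD rmorphM /= horner_mx_X horner_mx_C.
split=> [|i]; last first.
  by rewrite hornerD hornerM hornerX hornerC mxE diagpA diagp mxE eqxx.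
apply/is_trig_mxP => i j ltij; rewrite mxE (is_trig_mxP trigpA) // mxE.
by rewrite -val_eqE ltn_eqF // addr0.
Qed.

(* If [char_poly T = q * ('X - T j j) ^+ m] with [T j j] not a root of [q], then
   [q(T)] has a nonzero entry [(j, j)] and is killed by [(T - T j j) ^+ m]; [M]
   is the product of these [q(T)]. *)
Lemma trig_generalized_eigen (F : fieldType) n (s : seq 'M[F]_n.+1) (j : 'I_n.+1) :
  {in s &, forall T U, GRing.comm T U} -> (forall T, T \in s -> is_trig_mx T) ->
  exists M : 'M[F]_n.+1, [/\ is_trig_mx M, M j j != 0,
    forall B, (forall T, T \in s -> GRing.comm B T) -> GRing.comm B M &
    forall T, T \in s -> exists m, (T - (T j j)%:M) ^+ m * M = 0].
Proof.
elim: s => [|T s IHs] comm_s trig_s.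
  exists 1; split=> //; first exact: scalar_mx_is_trig.
    by rewrite mxE eqxx oner_neq0.
  by move=> B _; exact: commr1.
have sub_s U : U \in s -> U \in T :: s by rewrite inE orbC => ->.
have [||M [trigM Mjj comm_M nil_M]] := IHs.
- by move=> U V Us Vs; apply: comm_s; exact: sub_s.
- by move=> U Us; apply: trig_s; exact: sub_s.
have trigT := trig_s T (mem_head T s).
have [m [q]] := multiplicity_XsubC (char_poly T) (T j j).
rewrite monic_neq0 ?char_poly_monic //= => rootq def_q.
have [trigqT diagqT] := horner_mx_trig _ _ _ q trigT.
have [trigqTM diagqTM] := mulmx_trig _ _ _ _ trigqT trigM.
have comm_qT B : GRing.comm B T -> GRing.comm B (horner_mx T q).
  by move=> BT; exact: comm_mx_horner.
exists (horner_mx T q * M); split=> //.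
- by rewrite diagqTM diagqT mulf_neq0.
- move=> B comm_B; apply: commrM.
    by apply: comm_qT; apply: comm_B; exact: mem_head.
  by apply: comm_M => U Us; apply: comm_B; exact: sub_s.
move=> U; rewrite inE => /predU1P[->|Us].
  exists m; rewrite mulrA.
  have -> : (T - (T j j)%:M) ^+ m = horner_mx T (('X - (T j j)%:P) ^+ m).
    by rewrite rmorphXn rmorphB /= horner_mx_X horner_mx_C.
  by rewrite -rmorphM /= mulrC -def_q Cayley_Hamilton mul0r.
have [l nil_l] := nil_M U Us; exists l.
have UqT : GRing.comm (horner_mx T q) ((U - (U j j)%:M) ^+ l).
  apply: commrX; apply: commrB; last exact: comm_mx_scalar.
  by apply: commr_sym; apply: comm_qT; apply: comm_s; rewrite ?mem_head ?sub_s.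
by rewrite mulrA -UqT -mulrA nil_l mulr0.
Qed.

(** The shifts [T - T j j] commute and are all nilpotent on the nonzero matrix [M], so some [K * M],
    still nonzero, is killed by all of them at once; any nonzero column of it is the vector
    sought. *)
Lemma trig_common_eigenvector (F : fieldType) n (s : seq 'M[F]_n) (j : 'I_n) :
  {in s &, forall T U, comm_mx T U} -> (forall T, T \in s -> is_trig_mx T) ->
  exists2 v : 'cV[F]_n, v != 0 & forall T, T \in s -> T *m v = T j j *: v.
Proof.
(* The ring structure on square matrices needs positive size; in size 0 there is no index [j]. *)
case: n s j => [|n] s j comm_s trig_s; first by case: j.
have [M [_ Mjj comm_M nil_M]] := trig_generalized_eigen F n s j comm_s trig_s.
have M0 : M != 0 by apply: contraNneq Mjj => ->; rewrite mxE.
pose shift (T : 'M[F]_n.+1) := T - (T j j)%:M.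
have [|T /mapP[U Us ->]|K [KM0 _ killK]] :=
    common_annihilator _ [seq shift T | T <- s] M _ M0.
- move=> _ _ /mapP[T Ts ->] /mapP[U Us ->].
  apply: commrB; last exact: comm_mx_scalar.
  apply: commr_sym; apply: commrB; last exact: comm_mx_scalar.
  exact: comm_s.
- exact: nil_M.
have [k colk] : exists k, col k (K * M) != 0.
  apply/existsP; apply: contraNT KM0 => /existsPn nocol.
  apply/eqP/matrixP => i k; have /negPn/eqP/matrixP/(_ i 0) := nocol k.
  by rewrite !mxE.
exists (col k (K * M)) => // T Ts; apply/eqP; rewrite -subr_eq0.
rewrite -mul_scalar_mx -mulmxBl colE mulmxA; apply/eqP.
have : shift T * (K * M) = 0 by apply: killK; exact: map_f.
by rewrite -!mulmxE => ->; rewrite mul0mx.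
Qed.

(** * From finite lists to arbitrary commuting families *)

(** Spans of finite lists of members have dimension at most [dim V]. For a list reaching the maximal
    such dimension, adding any [A i] cannot enlarge the span. *)
Lemma finite_spanning (K : fieldType) (V : vectType K) (I : Type) (A : I -> V) :
  exists2 s : seq V, (forall x, x \in s -> exists i, x = A i) &
    forall i, A i \in <<s>>%VS.
Proof.
pose P d := `[< exists2 s : seq V, (forall x, x \in s -> exists i, x = A i) &
  d = \dim <<s>>%VS >].
have exP : exists d, P d.
  by exists (\dim <<[::] : seq V>>%VS); apply/asboolP; exists [::].
have ubP d : P d -> (d <= dim V)%N.
  by move=> /asboolP[s _ ->]; rewrite -dimvf dimvS ?subvf.
case: (ex_maxnP exP ubP) => d /asboolP[s s_A ->] max_s.
exists s => // i; have /max_s : P (\dim <<A i :: s>>%VS).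
  apply/asboolP; exists (A i :: s) => // x; rewrite inE => /predU1P[->|/s_A//].
  by exists i.
rewrite span_cons => le_dim.
have /eqP -> : (<<s>> == <[A i]> + <<s>>)%VS by rewrite eqEdim addvSr.
exact: subvP (addvSl _ _) _ (memv_line _).
Qed.

Local Open Scope sesquilinear_scope.

(** Simultaneous triangularization handles a finite list, so it is applied to a spanning list [s].
    For fixed [v] the eigenvector equation is linear in the matrix, including its eigenvalue, a
    diagonal entry of the conjugate; it therefore passes from [s] to every [A i]. *)
Lemma unitary_joint_eigenvectors (C : numClosedFieldType) n (I : Type) (A : I -> 'M[C]_n) :
  (forall i j, A i *m A j = A j *m A i) ->
  exists2 P : 'M[C]_n, P \is unitarymx & forall j : 'I_n,
    exists2 v : 'cV[C]_n, v != 0 &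
      forall i, A i *m v = (P *m A i *m P^t*) j j *: v.
Proof.
move=> commA; have [s s_A span_s] := finite_spanning _ _ I A.
have comm_s : {in s &, forall T U, comm_mx T U}.
  by move=> T U /s_A[i ->] /s_A[k ->]; exact: commA.
have [P unitP /allP trigP] := cotrigonalization comm_s.
have PP : P^t* *m P = 1%:M.
  by rewrite -invmx_unitary // mulVmx // unitarymx_unit.
exists P => // j; pose f (T : 'M[C]_n) := P *m T *m P^t*.
have [||v v0 eig_v] := trig_common_eigenvector _ _ (map f s) j.
- move=> _ _ /mapP[T Ts ->] /mapP[U Us ->].
  have fM X Y : f X *m f Y = f (X *m Y).
    by rewrite /f !mulmxA -[_ *m P^t* *m P]mulmxA PP mulmx1.
  by rewrite /comm_mx !fM comm_s.
- by move=> _ /mapP[T Ts ->]; rewrite /f -conjymx //; exact: trigP.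
(* The eigenvector found in the triangular basis is carried back to the original one. *)
exists (P^t* *m v) => [|i].
  apply: contraNneq v0 => /(congr1 (mulmx P)).
  by rewrite mulmxA (unitarymxP unitP) mul1mx mulmx0 => ->.
have [c ->] : exists c : 'I_(size s) -> C, A i = \sum_k c k *: s`_k.
  exists (fun k => coord (in_tuple s) k (A i)).
  exact: (coord_span (X := in_tuple s)).
rewrite -/(f _) mulmx_suml.
have -> : f (\sum_k c k *: s`_k) j j = \sum_k c k * f s`_k j j.
  rewrite /f mulmx_sumr mulmx_suml summxE; apply: eq_bigr => k _.
  by rewrite -scalemxAr -scalemxAl mxE.
rewrite scaler_suml; apply: eq_bigr => k _.
rewrite -scalemxAl -scalerA; congr (_ *: _).
have -> : s`_k *m (P^t* *m v) = P^t* *m (f s`_k *m v).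
  by rewrite /f !mulmxA PP mul1mx.
by rewrite eig_v ?map_f ?mem_nth // -scalemxAr.
Qed.

(** * Norms, quadratic forms and the numerical range *)

Section NumericalRange.
Variables (R : realType) (n : nat).
Local Notation C := R[i].
Implicit Types (A M S U : 'M[C]_n) (u v : 'cV[C]_n).

(** Bridge between the real-valued norms and complex matrix algebra: norm identities are proved in
    [C] and brought back to [R] by [complexI]. *)
Lemma cabs2E (z : C) : (cabs2 z)%:C%C = z^* * z.
Proof.
case: z => a b; apply/eqP; rewrite eq_complex /cabs2 /= !expr2.
by rewrite !mulNr opprK [b * a]mulrC subrr !eqxx.
Qed.

Lemma vnorm2E v : (vnorm2 v)%:C%C = (v^t* *m v) 0 0.
Proof.
by rewrite /vnorm2 rmorph_sum mxE; apply: eq_bigr => j _; rewrite /= cabs2E !mxE.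
Qed.

Lemma adjE A : adj A = A^t*.
Proof. by apply/matrixP => i j; rewrite !mxE. Qed.

Lemma trmxC_mul m p q (A : 'M[C]_(m, p)) (B : 'M[C]_(p, q)) :
  (A *m B)^t* = B^t* *m A^t*.
Proof. by rewrite trmx_mul map_mxM. Qed.

(** Taking the real part gives an additive function of [M] with values in an ordered field; on Gram
    matrices nothing is lost, as [re_form_gram] shows. *)
Definition re_form M v : R := complex.Re (cdot v (M *m v)).

Lemma re_formE M v : re_form M v = complex.Re ((v^t* *m M *m v) 0 0).
Proof.
by rewrite /re_form -mulmxA [(v^t* *m _) 0 0]mxE; congr complex.Re;
   apply: eq_bigr => j _; rewrite !mxE.
Qed.

Lemma re_formD v : {morph re_form^~ v : M S / M + S}.
Proof.
move=> M S; rewrite !re_formE mulmxDr mulmxDl mxE.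
by case: (fun_of_matrix _ _ _) (fun_of_matrix _ _ _) => [a b] [c d].
Qed.

Lemma re_form0 v : re_form 0 v = 0.
Proof. by rewrite re_formE mulmx0 mul0mx mxE. Qed.

Lemma re_formB M S v : re_form (M - S) v = re_form M v - re_form S v.
Proof. by apply: (addIr (re_form S v)); rewrite -re_formD !subrK. Qed.

Lemma re_form_sum (J : Type) (s : seq J) (F : J -> 'M[C]_n) v :
  re_form (\sum_(i <- s) F i) v = \sum_(i <- s) re_form (F i) v.
Proof. exact: (big_morph _ (re_formD v) (re_form0 v)). Qed.

Lemma re_form_gram A v : re_form (adj A *m A) v = vnorm2 (A *m v).
Proof.
by rewrite re_formE adjE !mulmxA -trmxC_mul -mulmxA -vnorm2E.
Qed.

Lemma vnorm2_unitary U v : U \is unitarymx -> vnorm2 (U *m v) = vnorm2 v.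
Proof.
move=> unitU; apply: complexI; rewrite !vnorm2E trmxC_mul mulmxA.
rewrite -[_ *m U^t* *m U]mulmxA -invmx_unitary //.
by rewrite mulVmx ?unitarymx_unit ?mulmx1.
Qed.

Lemma vnorm2Z (c : C) v : vnorm2 (c *: v) = cabs2 c * vnorm2 v.
Proof.
rewrite /vnorm2 mulr_sumr; apply: eq_bigr => j _; apply: complexI.
by rewrite rmorphM /= !cabs2E mxE rmorphM /= mulrACA.
Qed.

Lemma cabs2_ge0 (z : C) : 0 <= cabs2 z.
Proof. by rewrite addr_ge0 ?sqr_ge0. Qed.

Lemma hs2_ge0 M : 0 <= hs2 M.
Proof. by apply: sumr_ge0 => j _; apply: sumr_ge0 => k _; exact: cabs2_ge0. Qed.

Lemma vnorm2_normalize v : v != 0 -> exists c : C, vnorm2 (c *: v) = 1.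
Proof.
move=> v0; have nv_gt0 : 0 < vnorm2 v.
  rewrite lt0r sumr_ge0 ?andbT => [|j _]; last exact: cabs2_ge0.
  apply: contra_neq v0; rewrite /vnorm2 => nv0; apply/matrixP => j k.
  have /eqP : cabs2 (v j 0) = 0.
    by apply: (psumr_eq0P _ nv0) => // i _; exact: cabs2_ge0.
  rewrite ord1 mxE /cabs2; case: (v j 0) => a b /=.
  by rewrite paddr_eq0 ?sqr_ge0 // !sqrf_eq0 => /andP[/eqP-> /eqP->].
exists (Num.sqrt (vnorm2 v)^-1)%:C%C.
rewrite vnorm2Z /cabs2 /= expr0n addr0 sqr_sqrtr ?mulVf ?gt_eqF //.
by rewrite invr_ge0 ltW.
Qed.

Lemma hs2_cols M : hs2 M = \sum_j vnorm2 (col j M).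
Proof.
rewrite /hs2 exchange_big; apply: eq_bigr => j _; apply: eq_bigr => k _.
by rewrite mxE.
Qed.

Lemma hs2_offdiag M : hs2 (M - diag_mx (\row_j M j j)) =
  \sum_j (vnorm2 (col j M) - cabs2 (M j j)).
Proof.
rewrite hs2_cols; apply: eq_bigr => j _.
rewrite /vnorm2 (bigD1 j) //= [in RHS](bigD1 j) //= !mxE eqxx mulr1n subrr.
rewrite [RHS]addrAC subrr add0r {1}/cabs2 /= expr0n !add0r.
by apply: eq_bigr => k neqkj; rewrite !mxE (negPf neqkj) mulr0n subr0.
Qed.

Lemma hs2_unitaryl U M : U \is unitarymx -> hs2 (U *m M) = hs2 M.
Proof.
move=> unitU; rewrite !hs2_cols; apply: eq_bigr => j _.
by rewrite !colE -mulmxA vnorm2_unitary.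
Qed.

Lemma hs2_adj M : hs2 (adj M) = hs2 M.
Proof.
rewrite /hs2 exchange_big; apply: eq_bigr => j _; apply: eq_bigr => k _.
by rewrite mxE /cabs2; case: (M j k) => a b /=; rewrite sqrrN.
Qed.

Lemma hs2_unitaryr U M : U \is unitarymx -> hs2 (M *m U) = hs2 M.
Proof.
move=> unitU; rewrite -hs2_adj adjE trmxC_mul hs2_unitaryl ?trmxC_unitary //.
by rewrite -adjE hs2_adj.
Qed.

Lemma Re_le_cabs (z : C) : `|complex.Re z| <= cabs z.
Proof. by rewrite -sqrtr_sqr ler_wsqrtr // lerDl sqr_ge0. Qed.

Lemma normcE (z : C) : `|z| = (cabs z)%:C%C.
Proof. by case: z. Qed.

Lemma cabs_entry_le M j k : cabs (M j k) <= Num.sqrt (hs2 M).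
Proof.
rewrite ler_wsqrtr // /hs2 (bigD1 j) //= (bigD1 k) //= -addrA lerDl.
rewrite addr_ge0 // sumr_ge0 // => i _; first exact: cabs2_ge0.
by apply: sumr_ge0 => l _; exact: cabs2_ge0.
Qed.

Lemma cabs_coord_le v j : vnorm2 v = 1 -> cabs (v j 0) <= 1.
Proof.
move=> v1; rewrite -sqrtr1 ler_wsqrtr // -v1 /vnorm2 (bigD1 j) //= lerDl.
by apply: sumr_ge0 => l _; exact: cabs2_ge0.
Qed.

(** Crude count: [n ^ 2] terms, each at most the norm of [M]. It yields both the boundedness of the
    numerical range and the continuity of the form in [M]. *)
Lemma cabs_form_le M v :
  vnorm2 v = 1 -> cabs (cdot v (M *m v)) <= (n ^ 2)%:R * Num.sqrt (hs2 M).
Proof.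
move=> v1; rewrite -lecR -normcE /cdot; apply: le_trans (ler_norm_sum _ _ _) _.
have le_v j : `|v j 0| <= 1 by rewrite normcE -[1]/(1%:C)%C lecR cabs_coord_le.
apply: (@le_trans _ _ (\sum_(j < n) \sum_(k < n) (Num.sqrt (hs2 M))%:C%C)).
  apply: ler_sum => j _; rewrite normrM norm_conjC.
  apply: le_trans (ler_piMl _ (le_v j)) _ => //.
  rewrite mxE; apply: le_trans (ler_norm_sum _ _ _) _; apply: ler_sum => k _.
  rewrite normrM; apply: le_trans (ler_piMr _ (le_v k)) _ => //.
  by rewrite normcE lecR cabs_entry_le.
rewrite !sumr_const !card_ord -mulrnA -mulnn.
by rewrite rmorphM /= rmorph_nat mulr_natl.
Qed.

Lemma re_form_le M v :
  vnorm2 v = 1 -> `|re_form M v| <= (n ^ 2)%:R * Num.sqrt (hs2 M).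
Proof. by move=> v1; apply: le_trans (Re_le_cabs _) _; exact: cabs_form_le. Qed.

Lemma re_form_spread S u v : vnorm2 u = 1 -> vnorm2 v = 1 ->
  re_form S u - re_form S v <= numspread S.
Proof.
move=> u1 v1; set z := cdot u (S *m u); set w := cdot v (S *m v).
apply: (@le_trans _ _ (cabs (z - w))).
  apply: le_trans (ler_norm _) _; apply: le_trans (Re_le_cabs _).
  by rewrite /re_form -/z -/w; case: z w => [a b] [c d].
apply: ub_le_sup; last by exists z; [exists u | exists w => //; exists v].
(* An upper bound must be exhibited before [sup] is known to dominate the elements of the set. *)
exists ((n ^ 2)%:R * Num.sqrt (hs2 S) *+ 2).
move=> _ [_ [x [x1 ->]] [_ [y [y1 ->]] <-]].
rewrite -lecR -normcE; apply: le_trans (ler_normB _ _) _.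
by rewrite !normcE mulr2n rmorphD lerD // lecR cabs_form_le.
Qed.

End NumericalRange.

Arguments re_form {R n} M v.

(** * Diagonal compressions and the passage to the limit *)

Theorem theorem1p2 (R : realType) (n : nat) (I : choiceType)
    (A : I -> 'M[R[i]]_n) (S : 'M[R[i]]_n) :
  (0 < n)%N ->
  (forall i j, A i *m A j = A j *m A i) ->
  has_sum (fun i => adj (A i) *m A i) S ->
  exists B : I -> 'M[R[i]]_n,
    [/\ (forall i j, B i *m B j = B j *m B i),
        (forall i, normal_cmx (B i)) &
        (\esum_(i in [set: I]) (hs2 (A i - B i))%:E <= (n%:R * numspread S)%:E)%E].
Proof.
move=> n_gt0 commA sumS.
have [P unitP eigP] := unitary_joint_eigenvectors _ _ _ A commA.
have unitPt : P^t* \is unitarymx by rewrite trmxC_unitary.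
have PPt : P *m P^t* = 1%:M by exact/unitarymxP.
have PtP : P^t* *m P = 1%:M by rewrite -invmx_unitary // mulVmx ?unitarymx_unit.
pose T i := P *m A i *m P^t*.
pose diagT i := \row_j T i j j.
(* The matrices [B d] commute with one another and are closed under adjoints, so normality is a case
   of [commB]. *)
pose B (d : 'rV[R[i]]_n) := P^t* *m diag_mx d *m P.
have mulB d e : B d *m B e = P^t* *m (diag_mx d *m diag_mx e) *m P.
  by rewrite /B !mulmxA -[_ *m P *m P^t*]mulmxA PPt mulmx1.
have commB d e : B d *m B e = B e *m B d by rewrite !mulB diag_mxC.
have adjB d : adj (B d) = B (map_mx Num.conj d).
  by rewrite adjE /B !trmxC_mul trmxCK tr_diag_mx map_diag_mx mulmxA.
(* Each [xi j] serves all [i] at once; this is what later lets the sum over [i] move inside the form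
   at [xi j]. *)
have /fin_all_exists2[xi xi1 eig_xi] : forall j : 'I_n,
    exists2 v : 'cV[R[i]]_n, vnorm2 v = 1 & forall i, A i *m v = T i j j *: v.
  move=> j; have [v /vnorm2_normalize[c cv1] eig_v] := eigP j.
  by exists (c *: v) => // i; rewrite -scalemxAr eig_v !scalerA mulrC.
pose x j := col j (P^t*).
have x1 j : vnorm2 (x j) = 1.
  apply: complexI; rewrite /x colE vnorm2_unitary // /vnorm2 (bigD1 j) //=.
  rewrite big1 => [|k neqkj].
    by rewrite mxE !eqxx /cabs2 /= expr1n expr0n !addr0.
  by rewrite mxE (negPf neqkj) /cabs2 /= expr0n addr0.
have hsAB i : hs2 (A i - B (diagT i)) =
    \sum_j (re_form (adj (A i) *m A i) (x j) -
             re_form (adj (A i) *m A i) (xi j)).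
  have -> : A i - B (diagT i) = P^t* *m (T i - diag_mx (diagT i)) *m P.
    by rewrite mulmxBr mulmxBl /T !mulmxA PtP mul1mx -(mulmxA _ _ P) PtP mulmx1.
  rewrite hs2_unitaryr // hs2_unitaryl // hs2_offdiag; apply: eq_bigr => j _.
  rewrite !re_form_gram eig_xi vnorm2Z xi1 mulr1; congr (_ - _).
  (* Column [j] of [T i] is [P] applied to [A i *m x j], and [P] preserves norms. *)
  by rewrite -[RHS](vnorm2_unitary _ _ P) // /x !colE !mulmxA.
exists (fun i => B (diagT i)); split=> [i j|i|]; first exact: commB.
  by rewrite /normal_cmx adjB commB.
(* The infinite sum is the supremum of its finite partial sums, so each of these is bounded up to an
   arbitrary [e]. *)
apply: ge_ereal_sup => _ [J [finJ _] <-].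
apply/lee_addgt0Pr => e e_gt0.
(* Replacing a partial sum by [S] costs at most [(n ^ 2)%:R * (e / c)] at each of the [2 * n]
   vectors [x j] and [xi j], hence [e] in total. *)
pose c : R := (n ^ 2)%:R *+ (2 * n).
have c_gt0 : 0 < c by rewrite pmulrn_rgt0 ?ltr0n ?expn_gt0 ?muln_gt0 ?n_gt0.
have [J0 [finJ0 nearS]] := sumS (e / c) (divr_gt0 e_gt0 c_gt0).
(* Enlarging [J] by [J0] only adds nonnegative terms and brings the matrix sum close to [S]. *)
have finU : finite_set (J `|` J0) by rewrite finite_setU.
have {}nearS := ltW (nearS _ finU (@subsetUr _ J J0)).
apply: (@le_trans _ _ (\sum_(i \in J `|` J0) (hs2 (A i - B (diagT i)))%:E)%E).
  apply: lee_fsum_nneg_subset => // [i|i _]; last by rewrite lee_fin hs2_ge0.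
  by rewrite !inE; left.
rewrite fsbig_finite //= sumEFin -EFinD lee_fin.
rewrite fsbig_finite //= in nearS.
set s := (X in \sum_(i <- X) _) in nearS *; set SJ := \sum_(i <- s) _ in nearS.
have -> : \sum_(i <- s) hs2 (A i - B (diagT i)) =
    \sum_j (re_form SJ (x j) - re_form SJ (xi j)).
  under eq_bigr do rewrite hsAB; rewrite exchange_big; apply: eq_bigr => j _.
  by rewrite sumrB -!re_form_sum.
apply: (@le_trans _ _ (\sum_(j < n) (numspread S + (n ^ 2)%:R * (e / c) *+ 2))).
  apply: ler_sum => j _.
  have near v : vnorm2 v = 1 ->
      `|re_form SJ v - re_form S v| <= (n ^ 2)%:R * (e / c).
    move=> v1; rewrite -re_formB; apply: le_trans (re_form_le _ _ _ _ v1) _.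
    by rewrite ler_wpM2l.
  have := re_form_spread _ _ S _ _ (x1 j) (xi1 j).
  have := near _ (x1 j); have := near _ (xi1 j).
  rewrite !ler_norml => /andP[lo _] /andP[_ hi] spread.
  lra.
rewrite sumr_const card_ord mulrnDl [n%:R * numspread S]mulr_natl lerD2l.
by rewrite -mulrnA -mulrnAl -/c mulrC divfK // gt_eqF.
Qed.
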